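(* For every integer $n\ge 2$, \[ \mathsf{InstC}(\mathsf{CONN}) = \frac{\mathsf{DT}(\mathsf{CONN})}{\mathsf{C}_{\mathsf{min}}(\mathsf{CONN})} = \frac{\binom{n}{2}}{n-1}. \] Moreover, there is an absolute constant $c>0$ such that for all integers $n \ge 2$ and $k$ with $2\le k\le c\, n^{2/3}$, \[ \mathsf{InstC}(\mathsf{CL}_{k}) = \frac{\mathsf{DT}(\mathsf{CL}_{k})}{\mathsf{C}_{\mathsf{min}}(\mathsf{CL}_{k})} = \frac{\binom{n}{2}}{\binom{k}{2}}. \]
   Context: Graphs on the vertex set $[n]$ are encoded as strings in $\{0,1\}^{\binom{n}{2}}$, one bit per unordered pair of vertices, the bit being 1 iff the edge is present. $\mathsf{CONN}:\{0,1\}^{\binom n2}\to\{0,1\}$ outputs 1 iff the graph is connected; $\mathsf{CL}_k:\{0,1\}^{\binom n2}\to\{0,1\}$ outputs 1 iff the graph contains a $k$-clique as a subgraph. For a Boolean function $f$ on $N$ variables: a deterministic decision tree is a rooted binary tree with internal nodes labeled by variables, edges labeled $0/1$, leaves labeled by outputs in $\{0,1\}$, evaluating an input by following the path determined by queried values; it computes $f$ if it outputs $f(x)$ for all $x$; $\mathcal{T}(x)$ is the number of queries on $x$. $\mathsf{DT}(f)$ is the minimum depth of a decision tree computing $f$. A certificate for $x$ is a set $S$ of variables such that $f(y)=f(x)$ for all $y$ agreeing with $x$ on $S$; $\mathsf{C}(f,x)$ is its minimum size; $\mathsf{C}_{\mathsf{min}}(f)=\min_x\mathsf{C}(f,x)$.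 $\mathsf{InstC}(f)=\min_{\mathcal{T}}\max_x \frac{\mathcal{T}(x)}{\mathsf{C}(f,x)}$ over decision trees $\mathcal{T}$ computing $f$. *)

(* Defs.v *)
From HB Require Import structures.
From mathcomp Require Import all_boot all_order all_algebra.
From mathcomp Require Import all_classical all_reals all_analysis.

Set Implicit Arguments.
Unset Strict Implicit.
Unset Printing Implicit Defensive.

Import Order.TTheory GRing.Theory Num.Theory.
Local Open Scope ring_scope.

Section Query.
Variable V : finType.

Definition input := {ffun V -> bool}.

Inductive dtree : Type :=
| Leaf of bool
| Query of V & dtree & dtree.

Implicit Types (T : dtree) (x y : input) (f : input -> bool) (S : {set V}).

(* In [Query v T0 T1], the subtree [T0] hangs from the 0-edge and [T1] from
   the 1-edge. *)
Fixpoint eval T x : bool :=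
  match T with
  | Leaf b => b
  | Query v T0 T1 => if x v then eval T1 x else eval T0 x
  end.

Fixpoint queries T x : nat :=
  match T with
  | Leaf _ => 0
  | Query v T0 T1 => (if x v then queries T1 x else queries T0 x).+1
  end.

Fixpoint depth T : nat :=
  match T with
  | Leaf _ => 0
  | Query _ T0 T1 => (maxn (depth T0) (depth T1)).+1
  end.

Definition computes T f : Prop := forall x, eval T x = f x.

Definition certificate f x S : bool :=
  [forall y : input, [forall v in S, y v == x v] ==> (f y == f x)].

(* The default value #|V| of the minimum is the size of the certificate made
   of all the variables. *)
Definition C f x : nat :=
  \big[minn/#|V|]_(S : {set V} | certificate f x S) #|S|.

(* Here too the default value is harmless: C f x <= #|V| for every x. *)
Definition Cmin f : nat := \big[minn/#|V|]_(x : input) C f x.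

Fixpoint full_tree f (s : seq V) x : dtree :=
  if s is v :: s' then
    Query v (full_tree f s' [ffun w => if w == v then false else x w])
            (full_tree f s' [ffun w => if w == v then true else x w])
  else Leaf (f x).

Lemma eval_full_tree f s x y :
  eval (full_tree f s x) y = f [ffun w => if w \in s then y w else x w].
Proof.
elim: s x => [|v s IH] x /=.
  by congr f; apply/ffunP => w; rewrite ffunE.
case: ifPn => [yv|/negbTE yv]; rewrite IH; congr f; apply/ffunP => w;
  by rewrite !ffunE in_cons; case: (w \in s); rewrite ?orbT ?orbF //;
     case: eqP => // ->; rewrite yv.
Qed.

Lemma full_tree_computes f : exists T, computes T f.
Proof.
exists (full_tree f (enum V) [ffun=> false]) => x.
rewrite eval_full_tree; congr f; apply/ffunP => w.
by rewrite ffunE mem_enum.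
Qed.

Lemma ex_depth f : exists d, `[< exists2 T, computes T f & depth T = d >].
Proof.
by have [T cT] := full_tree_computes f; exists (depth T); apply/asboolP; exists T.
Qed.

Definition DT f : nat := ex_minn (ex_depth f).

Section InstC.
Variable R : realType.

(* The inputs form a nonempty finite type and the ratios are nonnegative, so
   the default value 0 does not affect the maximum. When f is constant,
   C f x = 0 and the ratio is 0 since t / 0 = 0; the complexity is meant for
   nonconstant f. *)
Definition max_ratio f T : R :=
  \big[Num.max/0]_(x : input) ((queries T x)%:R / (C f x)%:R).

(* This infimum is a minimum, see InstC_attained and InstC_le. *)
Definition InstC f : R :=
  inf [set r : R | exists2 T, computes T f & max_ratio f T = r]%classic.

Lemma C_le f x : (C f x <= #|V|)%N.
Proof.
rewrite /C; elim/big_rec: _ => // S m _ h; exact: leq_trans (geq_minr _ _) h.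
Qed.

Lemma max_ratio_ge0 f T : 0 <= max_ratio f T.
Proof.
rewrite /max_ratio; elim/big_ind: _ => [|a b a0 b0|x _] //.
  by rewrite le_max a0.
Qed.

Lemma InstC_le f T : computes T f -> InstC f <= max_ratio f T.
Proof.
move=> cT; apply: ge_inf; last by exists T.
by exists 0 => _ [T' _ <-]; exact: max_ratio_ge0.
Qed.

Lemma max_ratioE f T :
  exists m : nat, max_ratio f T = m%:R / (factorial #|V|)%:R.
Proof.
have K0 : (factorial #|V|)%:R != 0 :> R by rewrite pnatr_eq0 -lt0n fact_gt0.
rewrite /max_ratio; elim/big_ind: _ => [|a b [m ->] [p ->]|x _].
- by exists 0%N; rewrite mul0r.
- by rewrite maxEle; case: ifP => _; [exists p|exists m].
- have [->|C0] := eqVneq (C f x) 0%N; first by exists 0%N; rewrite invr0 mulr0 mul0r.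
  have dv : (C f x %| (factorial #|V|))%N by apply: dvdn_fact; rewrite lt0n C0 C_le.
  exists (queries T x * ((factorial #|V|) %/ C f x))%N.
  have CR : (C f x)%:R != 0 :> R by rewrite pnatr_eq0.
  by apply/eqP; rewrite eqr_div // -!natrM -mulnA divnK.
Qed.

Lemma InstC_attained f : exists2 T, computes T f & max_ratio f T = InstC f.
Proof.
have ex : exists m : nat,
    `[< exists2 T, computes T f & max_ratio f T = m%:R / (factorial #|V|)%:R >].
  have [T cT] := full_tree_computes f; have [m hm] := max_ratioE f T.
  by exists m; apply/asboolP; exists T.
case: (ex_minnP ex) => m /asboolP[T cT hT] mmin.
exists T => //; apply/eqP; rewrite eq_le InstC_le // andbT.
apply: lb_le_inf; first by exists (max_ratio f T); exists T.
move=> _ [T' cT' <-]; have [m' hm'] := max_ratioE f T'.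
rewrite hT hm' ler_wpM2r ?invr_ge0 // ler_nat mmin //.
by apply/asboolP; exists T'.
Qed.

End InstC.
End Query.

Arguments InstC {V} R f.

Definition edge (n : nat) := {e : {set 'I_n} | #|e| == 2}.

Definition graph (n : nat) := input (edge n).

Lemma card_edge n : #|{: edge n}| = 'C(n, 2).
Proof. by rewrite card_sig -[n in RHS]card_ord -card_draws cardsE. Qed.

Definition adj (n : nat) (G : graph n) : rel 'I_n :=
  fun i j => [exists e : edge n, (val e == [set i; j]) && G e].

Definition CONN (n : nat) (G : graph n) : bool :=
  [forall i, forall j, connect (adj G) i j].

Definition CL (n k : nat) (G : graph n) : bool :=
  [exists K : {set 'I_n}, (#|K| == k) &&
    [forall i in K, forall j in K, (i != j) ==> adj G i j]].

Arguments CONN : clear implicits.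
Arguments CL : clear implicits.

(* Main.v *)
Require Import Defs.
From HB Require Import structures.
From mathcomp Require Import all_boot all_order all_algebra.
From mathcomp Require Import all_classical all_reals all_analysis.
(* all_classical shadows lemma names of these two files. *)
From mathcomp Require Import fintype finset.
From mathcomp Require Import zify.

(* If every certificate has size at least m and every decision tree for f
   reaches, after querying all the variables, an input with a certificate of
   size m, then InstC f = N / m, DT f = N and Cmin f = m. Such an input is
   produced by an adversary keeping f undetermined up to the last query, which
   is then answered 1: a 1-input of CONN with n - 1 edges, or any 1-input of
   CL_k, has a certificate of the required size.

   CONN: the adversary answers 0 unless the query is the last one between two
   components of the graph of 1-answers.

   CL_k: fix a set S of k - 2 vertices. Pairs inside S are answered 1. For x
   outside S, the pairs joining x to S are answered 1, except possibly the last
   one; x is open before that, then full or dead. Pairs outside S are answered 0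
   unless this would isolate an open vertex. The 1-edges outside S stay
   triangle-free, hence the only possible k-cliques consist of S and two
   adjacent full vertices, and no such clique appears before the last query.

   A 0-certificate of CL_k is the complement of a K_k-free graph; a greedy choice
   among the vertices of low degree shows that it has at least C(k,2) elements
   as soon as 8 k^3 <= n^2 and 4 k <= n. *)

Set Implicit Arguments.
Unset Strict Implicit.
Unset Printing Implicit Defensive.

Import Order.TTheory GRing.Theory Num.Theory.
Local Open Scope ring_scope.

(** * Adversaries *)

Section Adversary.
Variables (V : finType) (f : input V -> bool).
Local Open Scope nat_scope.

Definition switch_on (x : input V) (v : V) : input V :=
  [ffun w => (w == v) || x w].

Lemma switch_onE x v w : switch_on x v w = (w == v) || x w.
Proof. by rewrite ffunE. Qed.

Lemma queries_le_depth (T : dtree V) x : queries T x <= depth T.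
Proof.
by elim: T => //= v T0 h0 T1 h1; rewrite ltnS leq_max; case: ifP; rewrite ?h0 ?h1 ?orbT.
Qed.

Lemma depth_full_tree s x : depth (full_tree f s x) = size s.
Proof. by elim: s x => //= v s IH x; rewrite !IH maxnn. Qed.

(* In a state [P U x], [U] is the set of variables not queried yet and [x] the
   answers given so far, completed by 0 on [U]. *)
Variable P : {set V} -> input V -> Prop.

Hypothesis answer : forall (U : {set V}) (x : input V) (v : V), v \in U -> U != [set v] ->
  (forall w, w \in U -> x w = false) -> P U x ->
  P (U :\ v) x \/ P (U :\ v) (switch_on x v).
Hypothesis last_answer : forall (u : V) (x : input V), x u = false -> P [set u] x ->
  f x = false /\ f (switch_on x u) = true.

(** Querying the rest of [U] in any order under the adversary's rule ends with a single unqueried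
    variable, and its two values give opposite outputs. Both completions agree with the answers
    already given. *)
Lemma adversary_undetermined (U : {set V}) (x : input V) : U != set0 ->
  (forall w, w \in U -> x w = false) -> P U x ->
  exists y z : input V, [/\ forall w, w \notin U -> y w = x w,
    forall w, w \notin U -> z w = x w, f y = false & f z = true].
Proof.
have [m] := ubnP #|U|; elim: m U x => // m IH U x Um /set0Pn[v vU] x0 PUx.
have [eU|nU] := eqVneq U [set v].
  rewrite eU in PUx; have [fx fxv] := last_answer (x0 v vU) PUx.
  exists x, (switch_on x v); split=> // w.
  by rewrite eU inE switch_onE => /negbTE ->.
have Um' : #|U :\ v| < m by move: Um; rewrite (cardsD1 v U) vU.
have U'0 : U :\ v != set0.
  apply: contraNneq nU => h; rewrite eqEsubset sub1set vU andbT.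
  by rewrite -setD_eq0 h.
have [h|h] := answer vU nU x0 PUx.
- have [] := IH _ _ Um' U'0 _ h; first by move=> w /setD1P[_ /x0].
  move=> y [z [hy hz fy fz]]; exists y, z; split=> // w wU.
    by rewrite hy // !inE (negbTE wU) andbF.
  by rewrite hz // !inE (negbTE wU) andbF.
- have [] := IH _ _ Um' U'0 _ h.
    by move=> w /setD1P[/negbTE wv /x0]; rewrite switch_onE wv.
  move=> y [z [hy hz fy fz]]; exists y, z.
  have hw w : w \notin U -> switch_on x v w = x w.
    by move=> wU; rewrite switch_onE; case: eqP wU => // ->; rewrite vU.
  split=> // w wU.
    by rewrite hy ?hw // !inE (negbTE wU) andbF.
  by rewrite hz ?hw // !inE (negbTE wU) andbF.
Qed.

(** Induction on the tree. A leaf cannot occur while [U] is nonempty, as both outputs are still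
    possible; a repeated query follows the recorded answer, a new one the adversary's. Correctness
    of [T] is asked only for inputs agreeing with [x] off [U], so that it passes to subtrees. *)
Lemma adversary_subtree (T : dtree V) (U : {set V}) (x : input V) : U != set0 ->
  (forall w, w \in U -> x w = false) -> P U x ->
  (forall y : input V, (forall w, w \notin U -> y w = x w) -> Defs.eval T y = f y) ->
  exists u y, [/\ P [set u] y, y u = false,
    forall w, w \notin U -> switch_on y u w = x w
    & #|U| <= queries T (switch_on y u)].
Proof.
elim: T U x => [b|v T0 IH0 T1 IH1] U x U0 x0 PUx hT.
  have [y [z [hy hz fy fz]]] := adversary_undetermined U0 x0 PUx.
  by have := hT y hy; have := hT z hz; rewrite /= fy fz => ->.
have [vU|vU] := boolP (v \in U); last first.
  case xv : (x v).
  - have [|u [y [h1 h2 h3 h4]]] := IH1 U x U0 x0 PUx.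
      by move=> y hy; rewrite -hT //= hy // xv.
    by exists u, y; split=> //=; rewrite h3 // xv (leq_trans h4).
  - have [|u [y [h1 h2 h3 h4]]] := IH0 U x U0 x0 PUx.
      by move=> y hy; rewrite -hT //= hy // xv.
    by exists u, y; split=> //=; rewrite h3 // xv (leq_trans h4).
(* The last unqueried variable is answered 1, and this query accounts for the one element of [U]. *)
have [eU|nU] := eqVneq U [set v].
  rewrite eU in PUx; exists v, x; split=> //; first exact: x0.
  - by move=> w; rewrite eU inE switch_onE => /negbTE ->.
  - by rewrite eU cards1.
have U'0 : U :\ v != set0.
  apply: contraNneq nU => h; rewrite eqEsubset sub1set vU andbT.
  by rewrite -setD_eq0 h.
rewrite (cardsD1 v U) vU add1n.
have [h|h] := answer vU nU x0 PUx.
- have [||u [y [h1 h2 h3 h4]]] := IH0 _ _ U'0 _ h.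
  + by move=> w /setD1P[_ /x0].
  + move=> y hy; rewrite -hT /=; first by rewrite hy ?setD11 // x0.
    by move=> w wU; rewrite hy // !inE (negbTE wU) andbF.
  exists u, y; split=> //.
    by move=> w wU; rewrite h3 // !inE (negbTE wU) andbF.
  by rewrite /= h3 ?setD11 // x0.
- have hw w : w \notin U -> switch_on x v w = x w.
    by move=> wU; rewrite switch_onE; case: eqP wU => // ->; rewrite vU.
  have [||u [y [h1 h2 h3 h4]]] := IH1 _ _ U'0 _ h.
  + by move=> w /setD1P[/negbTE wv /x0]; rewrite switch_onE wv.
  + move=> y hy; rewrite -hT /=; first by rewrite hy ?setD11 // switch_onE eqxx.
    by move=> w wU; rewrite hy ?hw // !inE (negbTE wU) andbF.
  exists u, y; split=> //.
    by move=> w wU; rewrite h3 ?hw // !inE (negbTE wU) andbF.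
  by rewrite /= h3 ?setD11 // switch_onE eqxx.
Qed.

Lemma adversary_evasive (T : dtree V) : 0 < #|V| -> P [set: V] [ffun=> false] ->
  computes T f ->
  exists u y, [/\ P [set u] y, y u = false & #|V| <= queries T (switch_on y u)].
Proof.
move=> V0 P0 cT; have [|||u [y [h1 h2 _ h4]]] := @adversary_subtree T setT [ffun=> false] _ _ P0.
- by rewrite -card_gt0 cardsT.
- by move=> w _; rewrite ffunE.
- by move=> y _; exact: cT.
by exists u, y; rewrite -cardsT.
Qed.

End Adversary.

(** * From evasiveness to the value of [InstC] *)

Section Evasive.
Variables (V : finType) (f : input V -> bool).
Local Open Scope nat_scope.

Lemma bigminn_le (I : finType) d (p : pred I) (F : I -> nat) i :
  p i -> \big[minn/d]_(j | p j) F j <= F i.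
Proof.
move=> pi; have : i \in index_enum I by rewrite mem_index_enum.
elim: (index_enum I) => // j s IH; rewrite in_cons big_cons => /orP[/eqP <-|/IH h].
  by rewrite pi geq_minl.
by case: ifP => // _; exact: leq_trans (geq_minr _ _) h.
Qed.

Lemma C_le_card x (S : {set V}) : certificate f x S -> C f x <= #|S|.
Proof. exact: bigminn_le. Qed.

(** The bound [m <= #|V|] takes care of the default value of the minimum defining [C]. *)
Lemma C_ge x m : m <= #|V| -> (forall S, certificate f x S -> m <= #|S|) -> m <= C f x.
Proof.
move=> mV h; rewrite /C; elim/big_rec: _ => // S p cS mp.
by rewrite leq_min h.
Qed.

Lemma eval_full_tree_enum : computes (full_tree f (enum V) [ffun=> false]) f.
Proof.
move=> x; rewrite eval_full_tree; congr f; apply/ffunP => w.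
by rewrite ffunE mem_enum.
Qed.

(** The full tree has ratio at most [#|V| / m] everywhere because [C f x >= m]. Conversely every
    tree makes [#|V|] queries on some input with a certificate of size at most [m], so its maximal
    ratio is at least [#|V| / m]. *)
Lemma InstC_evasive (R : realType) m : 0 < m -> m <= #|V| ->
  (forall x S, certificate f x S -> m <= #|S|) ->
  (forall T, computes T f -> exists2 x, C f x <= m & #|V| <= queries T x) ->
  InstC R f = ((DT f)%:R / (Cmin f)%:R)%R /\ DT f = #|V| /\ Cmin f = m.
Proof.
move=> m0 mV hC hT.
have Cge x : m <= C f x by apply: C_ge => // S; exact: hC.
have eC : Cmin f = m.
  apply/eqP; rewrite eqn_leq; apply/andP; split.
    have [T cT] := full_tree_computes f; have [x Cx _] := hT T cT.
    by apply: leq_trans Cx; exact: bigminn_le.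
  by rewrite /Cmin; elim/big_rec: _ => // x p _ mp; rewrite leq_min Cge.
have eD : DT f = #|V|.
  rewrite /DT; case: ex_minnP => d /asboolP[T cT dT] dmin.
  apply/eqP; rewrite eqn_leq; apply/andP; split.
    have [T' cT' dT'] : exists2 T', computes T' f & depth T' = #|V|.
      exists (full_tree f (enum V) [ffun=> false]); first exact: eval_full_tree_enum.
      by rewrite depth_full_tree cardE.
    by apply: dmin; apply/asboolP; exists T'.
  have [x _ qx] := hT T cT.
  by rewrite -dT (leq_trans qx) // queries_le_depth.
split=> //; rewrite eD eC.
have m0R : (0 < m%:R :> R)%R by rewrite ltr0n.
apply/eqP; rewrite eq_le; apply/andP; split.
  apply: (le_trans (InstC_le R eval_full_tree_enum)).
  rewrite /max_ratio; elim/big_ind: _ => [|a b ha hb|x _].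
  - by rewrite divr_ge0.
  - by rewrite ge_max ha.
  - rewrite ler_pM ?invr_ge0 // ?ler_nat.
      by rewrite (leq_trans (queries_le_depth _ _)) // depth_full_tree -cardE.
    by rewrite lef_pV2 ?posrE ?ltr0n ?ler_nat ?Cge // (leq_trans m0).
have [T cT <-] := InstC_attained R f.
have [x Cx qx] := hT T cT.
apply: (le_trans (y := ((queries T x)%:R / (C f x)%:R)%R)).
  rewrite ler_pM ?invr_ge0 // ?ler_nat //.
  by rewrite lef_pV2 ?posrE ?ltr0n ?ler_nat // (leq_trans m0).
by rewrite /max_ratio; exact: (le_bigmax _ (fun x => (queries T x)%:R / (C f x)%:R)%R).
Qed.

End Evasive.

(** * Connectivity *)

Section Adjacency.
Variable n : nat.
Implicit Types (G : graph n) (e : edge n) (i j a b : 'I_n) (U : {set edge n}).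
Local Open Scope nat_scope.

(** This lets [adj] apply to the set of unqueried pairs as well as to the 1-answers. *)
Definition graph_of U : graph n := [ffun e => e \in U].

Lemma edgeP e : exists i j, i != j /\ val e = [set i; j].
Proof. by have /cards2P[i [j nij]] := valP e; exists i, j. Qed.

Lemma ex_edge i j : i != j -> exists e : edge n, val e = [set i; j].
Proof.
move=> nij; have h : #|[set i; j]| == 2 by rewrite cards2 nij.
by exists (Sub [set i; j] h).
Qed.

Lemma adjP G i j : reflect (exists2 e : edge n, val e = [set i; j] & G e) (adj G i j).
Proof.
apply: (iffP existsP) => [[e /andP[/eqP h1 h2]]|[e h1 h2]]; exists e => //.
by rewrite h1 eqxx.
Qed.

Lemma adj_edge G e i j : val e = [set i; j] -> adj G i j = G e.
Proof.
move=> he; apply/adjP/idP => [[e' he' h]|h]; last by exists e.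
by rewrite (_ : e = e') //; apply: val_inj; rewrite he he'.
Qed.

Lemma adj_sym G i j : adj G i j = adj G j i.
Proof. by apply/adjP/adjP => -[e he h]; exists e => //; rewrite setUC. Qed.

Lemma adj_irr G i : adj G i i = false.
Proof.
apply/negbTE/negP => /adjP[e he _]; have := valP e; rewrite he setUid cards1 //.
Qed.

Lemma adj_neq G i j : adj G i j -> i != j.
Proof. by apply: contraTneq => ->; rewrite adj_irr. Qed.

Lemma set2_eq i j a b : ([set i; j] == [set a; b]) =
  ((i == a) && (j == b)) || ((i == b) && (j == a)).
Proof.
apply/eqP/orP => [h|[]/andP[/eqP-> /eqP->] //]; last by rewrite setUC.
have ha : a \in [set i; j] by rewrite h set21.
have hb : b \in [set i; j] by rewrite h set22.
have hi : i \in [set a; b] by rewrite -h set21.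
have hj : j \in [set a; b] by rewrite -h set22.
move: ha hb hi hj; rewrite !inE.
by do 4!case/orP => /eqP ?; subst; rewrite ?eqxx; auto.
Qed.

Lemma adj_switch_on G e i j : adj (switch_on G e) i j = adj G i j || (val e == [set i; j]).
Proof.
apply/adjP/orP => [[e' he']|[/adjP[e' he' h]|/eqP he]].
- rewrite switch_onE => /orP[/eqP<-|h]; first by right; rewrite he'.
  by left; apply/adjP; exists e'.
- by exists e' => //; rewrite switch_onE h orbT.
- by exists e => //; rewrite switch_onE eqxx.
Qed.

Lemma adj_graph_ofD1 U e i j :
  adj (graph_of (U :\ e)) i j = adj (graph_of U) i j && (val e != [set i; j]).
Proof.
apply/adjP/andP => [[e' he']|[/adjP[e' he']]].
- rewrite ffunE !inE => /andP[ne h]; split; first by apply/adjP; exists e' => //; rewrite ffunE.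
  by apply: contraNneq ne => h'; apply/eqP/val_inj; rewrite he' h'.
- rewrite ffunE => h ne; exists e' => //; rewrite ffunE !inE h andbT.
  by apply: contraNneq ne => <-; rewrite he'.
Qed.

Lemma adj_graph_ofT i j : adj (graph_of setT) i j = (i != j).
Proof.
apply/idP/idP => [/adj_neq //|/ex_edge[e he]].
by rewrite (adj_edge _ he) ffunE inE.
Qed.

Lemma adj0 i j : adj ([ffun=> false] : graph n) i j = false.
Proof. by apply/negbTE/negP => /adjP[e _]; rewrite ffunE. Qed.

Lemma connect_adj_sym G : connect_sym (adj G).
Proof. by apply: sym_connect_sym => i j; rewrite adj_sym. Qed.

(** Off a certificate the input may be changed freely: to 0 here, to 1 in the next lemma. For a
    monotone function these are the two extreme completions. *)
Lemma certificate_true (f : graph n -> bool) G U :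
  certificate f G U -> f G -> f [ffun e => (e \in U) && G e].
Proof.
move=> /forallP/(_ [ffun e => (e \in U) && G e]) /implyP h fG.
rewrite (eqP (h _)) //; apply/forall_inP => e eU.
by rewrite ffunE eU.
Qed.

Lemma certificate_false (f : graph n -> bool) G U :
  certificate f G U -> f G = false -> f [ffun e => (e \in U) ==> G e] = false.
Proof.
move=> /forallP/(_ [ffun e => (e \in U) ==> G e]) /implyP h fG.
rewrite (eqP (h _)) //; apply/forall_inP => e eU.
by rewrite ffunE eU.
Qed.

End Adjacency.

(** * Certificates and evasiveness of [CONN] *)

Section Conn.
Variable n : nat.
Implicit Types (G : graph n) (e : edge n) (i j a b : 'I_n) (U : {set edge n}).
Local Open Scope nat_scope.

Lemma CONN_mono G G' : (forall e, G e -> G' e) -> CONN n G -> CONN n G'.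
Proof.
move=> sG /forallP h; apply/forallP => i; apply/forallP => j.
have := forallP (h i) j; apply: connect_sub => a b /adjP[e he Ge].
by apply: connect1; apply/adjP; exists e => //; exact: sG.
Qed.

(** Colours stand for components, and adding the edge from [i] to [j] unites their classes. *)
Definition merge (col : 'I_n -> 'I_n) (i j a : 'I_n) : 'I_n :=
  if col a == col j then col i else col a.

Lemma codom_merge_ge col i j :
  #|[set col a | a : 'I_n]| <= #|[set merge col i j a | a : 'I_n]|.+1.
Proof.
rewrite -add1n -(cards1 (col j)).
apply: leq_trans (leq_card_setU _ _); apply/subset_leq_card/subsetP => _ /imsetP[a _ ->].
rewrite !inE; have [//|h] := eqVneq (col a) (col j).
by apply/imsetP; exists a => //; rewrite /merge (negbTE h).
Qed.

Lemma codom_merge_lt col i j : col i != col j ->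
  #|[set merge col i j a | a : 'I_n]| < #|[set col a | a : 'I_n]|.
Proof.
move=> nij; apply/proper_card/properP; split.
  apply/subsetP => _ /imsetP[a _ ->]; rewrite /merge.
  by case: ifP => _; apply: imset_f.
exists (col j); first exact: imset_f.
apply/negP => /imsetP[a _]; rewrite /merge; case: ifPn => [_ h|h h'].
  by rewrite h eqxx in nij.
by rewrite h' eqxx in h.
Qed.

(** Start from [n] colours and add the edges one at a time: each merge loses at most one colour. *)
Lemma coloring_of_edges U : exists2 col : 'I_n -> 'I_n,
  (forall e i j, e \in U -> val e = [set i; j] -> col i = col j)
  & n <= #|[set col a | a : 'I_n]| + #|U|.
Proof.
have [m] := ubnP #|U|; elim: m U => // m IH U Um.
have [->|/set0Pn[e eU]] := eqVneq U set0.
  exists id; first by move=> e i j; rewrite inE.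
  by rewrite cards0 addn0 card_imset ?card_ord.
have [|col hcol hn] := IH (U :\ e); first by move: Um; rewrite (cardsD1 e U) eU.
have [i [j [nij he]]] := edgeP e.
exists (merge col i j).
- move=> e' a b e'U he'; have [ee|ne] := eqVneq e' e.
    have : [set i; j] == [set a; b] by rewrite -he -he' ee.
    by rewrite set2_eq /merge => /orP[]/andP[/eqP-> /eqP->]; rewrite eqxx; case: ifP => // /eqP.
  have := hcol e' a b; rewrite !inE ne e'U => /(_ isT he') h.
  by rewrite /merge h.
- apply: leq_trans hn _; rewrite (cardsD1 e U) eU addnA addn1 leq_add2r.
  exact: codom_merge_ge.
Qed.

Lemma CONN_card G : CONN n G -> n.-1 <= #|[set e | G e]|.
Proof.
have [n0|n0] := posnP n; first by rewrite [X in X.-1 <= _]n0.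
move=> cG; pose i0 := Ordinal n0; have [col hcol hm] := coloring_of_edges [set e | G e].
(* Colours are constant along paths, so a connected graph has a single colour. *)
have hc i j : col i = col j.
  have := forallP (forallP cG i) j; case/connectP => p.
  elim: p i => [|w p IH] i /= => [_ -> //|/andP[/adjP[e he Ge] hp] hj].
  by rewrite (hcol e i w) ?inE // (IH w).
suff h1 : #|[set col a | a : 'I_n]| <= 1.
  by rewrite -ltnS prednK // -add1n (leq_trans hm) // leq_add2r.
rewrite -(cards1 (col i0)); apply/subset_leq_card/subsetP => _ /imsetP[a _ ->].
by rewrite inE (hc a i0).
Qed.

(** If [A] is the component of [i] and [j] lies outside it, all pairs across the cut belong to [U].
    Joining each vertex of [A] other than [i] to [j], and each vertex outside [A] to [i], gives a
    double star of [n - 1] distinct crossing pairs. *)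
Lemma CONN_cut_card U : CONN n [ffun e => e \notin U] = false -> n.-1 <= #|U|.
Proof.
move=> /negbT /forallPn[i /forallPn[j nij]].
set G := [ffun e => e \notin U] in nij.
pose A := [set a | connect (adj G) i a].
have iA : i \in A by rewrite inE connect0.
have jA : j \notin A by rewrite inE.
have inU a b e : a \in A -> b \notin A -> val e = [set a; b] -> e \in U.
  move=> aA bA he; apply: contraR bA => eU; rewrite !inE in aA *.
  by rewrite (connect_trans aA) // connect1 //; apply/adjP; exists e; rewrite // ffunE.
pose F a := [set a; if a \in A then j else i].
have sF : [set F a | a in [set~ i]] \subset [set val e | e in U].
  apply/subsetP => _ /imsetP[a ai ->]; rewrite !inE in ai; rewrite /F.
  case: ifPn => aA.
  - have [|e he] := @ex_edge _ a j; first by apply: contraNneq jA => <-.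
    by apply/imsetP; exists e => //; exact: inU he.
  - have [//|e he] := @ex_edge _ a i.
    by apply/imsetP; exists e => //; apply: (@inU i a) => //; rewrite he setUC.
have := subset_leq_card sF; rewrite (card_in_imset (f := val)); last by move=> ? ? _ _ /val_inj.
rewrite card_in_imset ?cardsC1 ?card_ord //.
move=> a b; rewrite !inE => ai bi /eqP; rewrite /F set2_eq.
case/orP => [/andP[/eqP//]|/andP[/eqP ha /eqP hb]].
move: ha hb; case: ifPn => bA; case: ifPn => aA ha hb.
- by rewrite ha.
- by rewrite -hb eqxx in bi.
- by rewrite ha eqxx in ai.
- by rewrite ha eqxx in ai.
Qed.

Lemma CONN_certificate_card G U : certificate (CONN n) G U -> n.-1 <= #|U|.
Proof.
move=> cU; case fG : (CONN n G).
- apply: leq_trans (CONN_card (certificate_true cU fG)) _.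
  by apply/subset_leq_card/subsetP => e; rewrite inE ffunE => /andP[].
- apply: CONN_cut_card; apply: contraFF (certificate_false cU fG).
  by apply: CONN_mono => e; rewrite !ffunE => /negbTE ->.
Qed.

(* The colour classes are the components of the graph [G] of 1-answers. *)
Definition conn_state U G : Prop := exists col : 'I_n -> 'I_n,
  [/\ forall i j, adj (graph_of U) i j -> col i <> col j,
      forall i j, col i <> col j -> exists a b,
        [/\ col a = col i, col b = col j & adj (graph_of U) a b],
      forall i j, adj G i j -> col i = col j,
      forall i j, col i = col j -> connect (adj G) i j
    & #|[set col a | a : 'I_n]| + #|[set e | G e]| <= n].

Lemma card_switch_on G e : #|[set e' | switch_on G e e']| <= #|[set e' | G e']|.+1.
Proof.
apply: (@leq_trans (#|[set e]| + #|[set e' | G e']|)); last by rewrite cards1.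
apply: leq_trans (leq_card_setU _ _).
by apply/subset_leq_card/subsetP => e'; rewrite !inE switch_onE.
Qed.

(** If another unqueried pair joins the two classes at the ends of [e], the answer 0 keeps them
    linked. Otherwise the answer 1 merges them, and no unqueried pair falls inside the new class
    because [e] was the only one between the two. *)
Lemma conn_answer U G e : e \in U -> conn_state U G ->
  conn_state (U :\ e) G \/ conn_state (U :\ e) (switch_on G e).
Proof.
move=> eU [col [h1 h2 h3 h4 h5]].
have [i [j [nij he]]] := edgeP e.
have Uij : adj (graph_of U) i j by rewrite (adj_edge _ he) ffunE.
have cij := h1 _ _ Uij.
have [[a [b [ca cb Uab ne]]]|nab] := pselect (exists a b, [/\ col a = col i, col b = col j,
    adj (graph_of U) a b & val e != [set a; b]]).
  left; exists col; split=> //.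
  - by move=> x y; rewrite adj_graph_ofD1 => /andP[/h1].
  - move=> x y /[dup] cxy /h2[x' [y' [cx cy Uxy]]].
    have [exy|nxy] := eqVneq (val e) [set x'; y']; last first.
      by exists x', y'; rewrite adj_graph_ofD1 Uxy.
    move/eqP: exy; rewrite he set2_eq => /orP[]/andP[/eqP ix /eqP jy].
    + by exists a, b; rewrite adj_graph_ofD1 Uab ne ca cb ix jy.
    + by exists b, a; rewrite adj_graph_ofD1 adj_sym Uab setUC ne ca cb ix jy.
right; exists (merge col i j).
have mcol x y : col x = col y -> merge col i j x = merge col i j y.
  by rewrite /merge => ->.
split.
- move=> x y; rewrite adj_graph_ofD1 => /andP[Uxy ne] mxy.
  have := h1 _ _ Uxy; move: mxy; rewrite /merge.
  case: eqP => [cx|_]; case: eqP => [cy|_] // e1 e2.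
  + by rewrite cx cy in e2.
  + by apply: nab; exists y, x; rewrite adj_sym setUC.
  + by apply: nab; exists x, y.
- move=> x y mxy; have cxy : col x <> col y by move/mcol.
  have [x' [y' [cx cy Uxy]]] := h2 _ _ cxy.
  exists x', y'; split; [exact: mcol|exact: mcol|].
  rewrite adj_graph_ofD1 Uxy he set2_eq /=; apply/negP => /orP[]/andP[/eqP ex /eqP ey];
    apply: mxy; rewrite -(mcol _ _ cx) -(mcol _ _ cy) -ex -ey /merge !eqxx;
    by case: ifP => // /eqP.
- move=> x y; rewrite adj_switch_on => /orP[/h3/mcol//|].
  rewrite he set2_eq => /orP[]/andP[/eqP<- /eqP<-]; rewrite /merge !eqxx;
    by case: ifP => // /eqP.
- have sub x y : col x = col y -> connect (adj (switch_on G e)) x y.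
    move/h4; apply: connect_sub => a b ab; apply: connect1.
    by rewrite adj_switch_on ab.
  have cij' : connect (adj (switch_on G e)) i j.
    by apply: connect1; rewrite adj_switch_on he eqxx orbT.
  move=> x y; rewrite /merge; case: eqP => cx; case: eqP => cy cxy.
  + by apply: sub; rewrite cx cy.
  + rewrite connect_adj_sym (connect_trans (y := i)) //; first by apply: sub.
    by apply: connect_trans cij' _; apply: sub.
  + apply: (connect_trans (y := i)); first by apply: sub.
    by apply: connect_trans cij' _; apply: sub.
  + exact: sub.
(* One edge is gained and at least one colour is lost, so the bound on their sum survives. *)
- have := codom_merge_lt (introN eqP cij); have := card_switch_on G e => hs hm.
  by apply: leq_trans h5; apply: leq_trans (leq_add hm (leqnn _)); rewrite addSnnS leq_add2l.
Qed.

(** Any two classes are linked by an unqueried pair, which must be [e]; hence there are exactly two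
    classes, and at most [n - 2] edges before [e] is added. *)
Lemma conn_last U G e : U = [set e] -> conn_state U G ->
  [/\ CONN n G = false, CONN n (switch_on G e) & #|[set e' | switch_on G e e']| <= n.-1].
Proof.
move=> eU [col [h1 h2 h3 h4 h5]].
have [i [j [nij he]]] := edgeP e.
have Uij : adj (graph_of U) i j by rewrite (adj_edge _ he) ffunE eU inE.
have cij := h1 _ _ Uij.
have Ue a b : adj (graph_of U) a b -> [set i; j] == [set a; b].
  by move=> /adjP[e' he']; rewrite ffunE eU inE => /eqP ee; rewrite -he -ee he'.
have colP a : col a = col i \/ col a = col j.
  have [|nai] := pselect (col a = col i); first by left.
  have [a' [i' [ca ci /Ue]]] := h2 _ _ nai; rewrite set2_eq => /orP[]/andP[/eqP hi /eqP hj].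
    by left; rewrite hi ca.
  by right; rewrite hj ca.
split.
- apply/negbTE/negP => cG; apply: cij; have := forallP (forallP cG i) j.
  case/connectP => p; elim: p i {nij he Uij Ue colP} => [|w p IH] i /= => [_ -> //|/andP[/h3 -> hp] hj].
  exact: IH.
- have sub x y : col x = col y -> connect (adj (switch_on G e)) x y.
    move/h4; apply: connect_sub => a b ab; apply: connect1.
    by rewrite adj_switch_on ab.
  have cij' : connect (adj (switch_on G e)) i j.
    by apply: connect1; rewrite adj_switch_on he eqxx orbT.
  have ia a : connect (adj (switch_on G e)) i a.
    by case: (colP a) => /esym/sub // h; exact: connect_trans cij' h.
  apply/forallP => a; apply/forallP => b.
  by rewrite (connect_trans _ (ia b)) // connect_adj_sym.
- have h2c : 2 <= #|[set col a | a : 'I_n]|.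
    apply: leq_trans (_ : #|[set col i; col j]| <= _).
      by rewrite cards2; case: eqP.
    by apply/subset_leq_card; rewrite subUset !sub1set !imset_f.
  have := leq_trans (leq_add h2c (leqnn _)) h5; have := card_switch_on G e.
  move: #|_| #|_|; case: n => [|m] p q; last by rewrite add2n !ltnS => /leq_trans h /h.
  by rewrite add2n.
Qed.

Lemma conn_evasive (T : dtree (edge n)) : 2 <= n -> computes T (CONN n) ->
  exists2 G, C (CONN n) G <= n.-1 & #|{: edge n}| <= queries T G.
Proof.
move=> n2 cT.
have [||||e [G [PG Ge qG]]] := @adversary_evasive _ (CONN n) conn_state _ _ T _ _ cT.
- by move=> U x v vU _ _; exact: conn_answer.
- by move=> u x _ /(conn_last erefl)[].
- by rewrite card_edge bin_gt0.
- exists id; split=> //.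
  + by move=> i j; rewrite adj_graph_ofT => /eqP.
  + by move=> i j /eqP nij; exists i, j; rewrite adj_graph_ofT.
  + by move=> i j; rewrite adj0.
  + by move=> i j ->.
  + have -> : [set e : edge n | ([ffun=> false] : graph n) e] = set0.
      by apply/setP => e; rewrite !inE ffunE.
    by rewrite card_imset ?card_ord ?cards0 ?addn0.
exists (switch_on G e) => //.
have [_ c1 c2] := conn_last erefl PG.
(* By monotonicity the 1-edges of the final graph form a certificate. *)
apply: leq_trans c2; apply: C_le_card; apply/forallP => y; apply/implyP => /forall_inP hy.
rewrite c1; apply/eqP; apply: CONN_mono c1 => e' h.
by rewrite (eqP (hy e' _)) // inE.
Qed.

End Conn.

(** * Cliques *)

(* The part of the game outside S: [U] and [Y] are the unqueried pairs and the
   1-answers, [op] and [fu] the open and the full vertices; the others are dead. *)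
Section Core.
Variable T : Type.
Implicit Types (U Y : T -> T -> Prop) (op fu : T -> Prop).

Definition same_pair (i j a b : T) := (a = i /\ b = j) \/ (a = j /\ b = i).

Definition finished U x := forall z, ~ U x z.

Definition live op fu (x : T) : Prop := op x \/ fu x.

(** A leaf has at most one live neighbour, so by [core_leaf] the 1-edges between live vertices form
    disjoint stars. *)
Definition leaf U Y op fu x := [/\ op x, finished U x &
  forall y z, Y x y -> live op fu y -> Y x z -> live op fu z -> y = z].

(* [core_fin] and [core_fin2] hold because a pair is answered 1 only when it is
   the last one at one of its ends; they imply that no triangle gets closed. *)
Record core U Y op fu : Prop := Core {
  core_Usym : forall x y, U x y -> U y x;
  core_Ysym : forall x y, Y x y -> Y y x;
  core_opfu : forall x, op x -> ~ fu x;
  core_live : forall x y, U x y -> live op fu x;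
  core_linked : forall x, op x ->
    (exists y, U x y) \/ (exists2 y, Y x y & live op fu y);
  core_leaf : forall x y, Y x y -> live op fu x -> live op fu y ->
    leaf U Y op fu x \/ leaf U Y op fu y;
  core_fin : forall x y, Y x y -> finished U x \/ finished U y;
  core_fin2 : forall z x y, Y z x -> Y z y -> x <> y -> finished U x \/ finished U y;
  core_trifree : forall x y z, Y x y -> Y y z -> Y x z -> False }.

Lemma core_irr U Y op fu x : core U Y op fu -> ~ Y x x.
Proof. by move=> h hx; exact: (core_trifree h hx hx hx). Qed.

(** One end of a live 1-edge is a leaf, hence open and not full. *)
Lemma core_no_clique U Y op fu x y : core U Y op fu -> Y x y -> fu x -> ~ fu y.
Proof.
move=> h xy fx fy; have := core_leaf h xy (or_intror fx) (or_intror fy).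
by case=> -[/(core_opfu h)].
Qed.

(** The link promised by [core_linked] can only be a full neighbour when nothing else is open or
    unqueried. *)
Lemma core_last_op U Y op fu j : core U Y op fu -> op j ->
  (forall x y, ~ U x y) -> (forall x, op x -> x = j) -> exists2 y, Y j y & fu y.
Proof.
move=> h oj nU o1; case: (core_linked h oj) => [[y /nU//]|[y jy [oy|fy]]].
  by move: jy; rewrite (o1 _ oy) => /(core_irr h).
by exists y.
Qed.

(** This decides the fate of [j] at its last pair to [S]. If some live neighbour [y] of [j] is not a
    leaf, then [j] is a leaf hanging from [y] and may die. Otherwise all live neighbours of [j] are
    leaves and [j] may become full, each live 1-edge at [j] keeping a leaf at its other end. *)
Lemma core_close U Y op fu j : core U Y op fu -> op j ->
  core U Y (fun x => op x /\ x <> j) (fun x => fu x \/ x = j) \/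
  core U Y (fun x => op x /\ x <> j) fu.
Proof.
move=> h oj.
have [[y [jy ly nly]]|hleaf] := pselect (exists y, [/\ Y j y, live op fu y & ~ leaf U Y op fu y]).
- right; have lj : leaf U Y op fu j.
    by case: (core_leaf h jy (or_introl oj) ly).
  case: (lj) => _ finj uj.
  have nfj : ~ fu j := core_opfu h oj.
  have lvW x : live (fun x => op x /\ x <> j) fu x -> live op fu x /\ x <> j.
    by case=> [[ox xj]|fx]; split=> //; [left|right|move=> xj; apply: nfj; rewrite -xj].
  have lvS x : live op fu x -> x <> j -> live (fun x => op x /\ x <> j) fu x.
    by case=> [ox|fx] xj; [left|right].
  have leafW x : leaf U Y op fu x -> x <> j -> leaf U Y (fun x => op x /\ x <> j) fu x.
    by case=> ox fx ux xj; split=> // a b xa /lvW[la _] xb /lvW[lb _]; exact: ux.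
  split; [exact: core_Usym h|exact: core_Ysym h|..].
  + by move=> x [/(core_opfu h)].
  + move=> x z xz; apply: lvS; first exact: (core_live h xz).
    by move=> xj; apply: (finj z); rewrite -xj.
  (* A vertex linked to [j] must be [y]; not being a leaf, [y] has an unqueried pair or a second
     live neighbour. *)
  + move=> x [ox xj]; case: (core_linked h ox) => [|[w xw lw]]; first by left.
    have [wj|wj] := pselect (w = j); last by right; exists w => //; exact: lvS.
    have xy : x = y.
      by apply: uj => //; [rewrite -wj; exact: (core_Ysym h xw)|left].
    have [nU|] := pselect (finished U x); last first.
      by move=> /existsNP[z /contrapT hz]; left; exists z.
    right; apply: contrapT => nex; apply: nly; rewrite -xy; split=> // a b xa la xb lb.
    have aj c : Y x c -> live op fu c -> c = j.
      move=> xc lc; apply: contrapT => cj; apply: nex; exists c => //; exact: lvS.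
    by rewrite (aj a) // (aj b).
  + move=> x w xw /lvW[lx xj] /lvW[lw wj].
    by case: (core_leaf h xw lx lw) => hl; [left|right]; apply: leafW.
  + exact: core_fin h.
  + exact: core_fin2 h.
  + exact: core_trifree h.
- left.
  have lvE x : live (fun x => op x /\ x <> j) (fun x => fu x \/ x = j) x <-> live op fu x.
    split=> [[[ox _]|[fx|->]]|]; [by left|by right|by left|].
    by case=> [ox|fx]; [have [->|xj] := pselect (x = j); [right; right|left]|right; left].
  have leafW x : leaf U Y op fu x -> x <> j ->
      leaf U Y (fun x => op x /\ x <> j) (fun x => fu x \/ x = j) x.
    by case=> ox fx ux xj; split=> // a b xa /lvE la xb /lvE lb; exact: ux.
  have nb y : Y j y -> live op fu y -> leaf U Y op fu y.
    by move=> jy ly; apply: contrapT => nl; apply: hleaf; exists y.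
  split; [exact: core_Usym h|exact: core_Ysym h|..].
  + by move=> x [/(core_opfu h) nf xj] [].
  + by move=> x z xz; apply/lvE; exact: (core_live h xz).
  + move=> x [ox xj]; case: (core_linked h ox) => [|[w xw lw]]; first by left.
    by right; exists w => //; apply/lvE.
  + move=> x w xw /lvE lx /lvE lw.
    have xNw : x <> w by move=> e; move: xw; rewrite e => /(core_irr h).
    have [xj|xj] := pselect (x = j).
      right; apply: leafW; first by apply: nb => //; rewrite -xj.
      by rewrite -xj => e; apply: xNw.
    have [wj|wj] := pselect (w = j).
      by left; apply: leafW => //; apply: nb => //; rewrite -wj; exact: (core_Ysym h xw).
    by case: (core_leaf h xw lx lw) => hl; [left|right]; apply: leafW.
  + exact: core_fin h.
  + exact: core_fin2 h.
  + exact: core_trifree h.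
Qed.

(** A common neighbour of [i] and [j] would make one of them finished by [core_fin2], although the
    pair is still unqueried. *)
Lemma core_add_trifree U Y Y' op fu i j : core U Y op fu -> U i j -> i <> j ->
  (forall a b, Y' a b <-> Y a b \/ same_pair i j a b) ->
  forall x y z, Y' x y -> Y' y z -> Y' x z -> False.
Proof.
move=> h Uij nij hY; have Uji := core_Usym h Uij.
have Y'sym x y : Y' x y -> Y' y x.
  by move=> /hY[/(core_Ysym h) xy|[][-> ->]]; apply/hY; [left|right; right|right; left].
have nocom z : Y z i -> ~ Y z j.
  by move=> zi zj; case: (core_fin2 h zi zj nij) => [/(_ j)|/(_ i)].
have nsp x : ~ Y' x x.
  by move=> /hY[/(core_irr h)//|[][-> e]]; apply: nij; rewrite e.
(* The case where the first side is the new pair; the other sides reduce to it by symmetry. *)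
have key x y z : same_pair i j x y -> Y' y z -> Y' x z -> False.
  move=> sp yz xz.
  move: (yz) (xz) => /hY[yz'|spy] /hY[xz'|spx].
  + case: sp yz' xz' => -[-> ->] /(core_Ysym h) a /(core_Ysym h) b.
      exact: (nocom _ b a).
    exact: (nocom _ a b).
  + have e : z = y.
      by case: sp spx => -[-> ->] [][e1 e2] //; case: nij; rewrite e1.
    by apply: (nsp y); rewrite -{2}e.
  + have e : z = x.
      by case: sp spy => -[-> ->] [][e1 e2] //; case: nij; rewrite e1.
    by apply: (nsp x); rewrite -{2}e.
  + have e : z = x.
      by case: sp spy => -[-> ->] [][e1 e2] //; case: nij; rewrite e1.
    by apply: (nsp x); rewrite -{2}e.
move=> x y z xy yz xz.
move: (xy) => /hY[xy'|sp]; last exact: (key _ _ _ sp yz xz).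
move: (yz) => /hY[yz'|sp]; last by apply: (key _ _ x sp); exact: Y'sym.
move: (xz) => /hY[xz'|sp]; first exact: (core_trifree h xy' yz' xz').
by apply: (key _ _ y sp) => //; exact: Y'sym.
Qed.

(** The answer 0 would isolate the open vertex [i]. With the answer 1, [i] is finished and becomes a
    leaf hanging from [j], which settles the conditions on the new edge. *)
Lemma core_attach U Y U' Y' op fu i j : core U Y op fu -> U i j -> i <> j ->
  (forall a b, U' a b <-> U a b /\ ~ same_pair i j a b) ->
  (forall a b, Y' a b <-> Y a b \/ same_pair i j a b) ->
  op i -> (forall z, U i z -> z = j) -> (forall z, Y i z -> ~ live op fu z) ->
  core U' Y' op fu.
Proof.
move=> h Uij nij hU hY oi Ui Yi.
have Uji := core_Usym h Uij.
have spS a b : same_pair i j a b -> same_pair i j b a.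
  by case=> -[-> ->]; [right|left].
have finW x : finished U x -> finished U' x by move=> fx z /hU[/fx].
have fini : finished U' i by move=> z /hU[/Ui->]; apply; left.
have nfini : ~ finished U i by move/(_ j).
have nfinj : ~ finished U j by move/(_ i).
have Y'sym x y : Y' x y -> Y' y x.
  by move=> /hY[/(core_Ysym h)|/spS] xy; apply/hY; [left|right].
(* An old leaf with a live neighbour is neither [i], which has none, nor [j], which was not
   finished; the new edge does not touch it. *)
have leafW x w : Y x w -> live op fu w -> leaf U Y op fu x -> leaf U' Y' op fu x.
  move=> xw lw [ox fx ux].
  have xi : x <> i by move=> e; move: xw lw; rewrite e => /Yi.
  have xj : x <> j by move=> e; apply: nfinj; rewrite -e.
  have Yx a : Y' x a -> Y x a by move=> /hY[//|[][/esym]] // /esym.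
  by split=> //; [exact: finW|move=> a b /Yx xa la /Yx xb lb; exact: ux].
have leafi : leaf U' Y' op fu i.
  have uj a : Y' i a -> live op fu a -> a = j.
    by move=> /hY[/Yi//|[[]//|[/nij]]].
  by split=> // a b /uj ea /ea -> /uj eb /eb ->.
split=> //.
- by move=> x y /hU[/(core_Usym h) yx ns]; apply/hU; split=> // /spS.
- exact: core_opfu h.
- by move=> x y /hU[/(core_live h)].
- move=> x ox; case: (core_linked h ox) => [[y xy]|[y xy ly]]; last first.
    by right; exists y => //; apply/hY; left.
  have [sp|nsp] := pselect (same_pair i j x y); last by left; exists y; apply/hU.
  right; exists y; first by apply/hY; right.
  exact: (core_live h (core_Usym h xy)).
- move=> x y /hY[xy lx ly|[][-> ->] _ _]; [|by left|by right].
  case: (core_leaf h xy lx ly) => hl; [left|right].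
    exact: (leafW _ _ xy ly hl).
  exact: (leafW _ _ (core_Ysym h xy) lx hl).
- move=> x y /hY[/(core_fin h)[] /finW hf|[][-> ->]]; by [left|right].
- move=> z x y /hY[zx|[][-> ->]] /hY[zy|[][e1 ->]] // xy; try by [left|right].
  + by case: (core_fin2 h zx zy xy) => /finW; [left|right].
  (* An earlier neighbour of [i] is finished by [core_fin], since [i] itself was not. *)
  + move: zx; rewrite e1 => /(core_fin h)[/nfini//|/finW]; by left.
  + by case: (core_fin h zy) => [/nfini//|/finW]; right.
- exact: (core_add_trifree h Uij nij hY).
Qed.

Lemma core_edge U Y U' Y' op fu i j : core U Y op fu -> U i j -> i <> j ->
  (forall a b, U' a b <-> U a b /\ ~ same_pair i j a b) ->
  (forall a b, Y' a b <-> Y a b \/ same_pair i j a b) ->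
  core U' Y op fu \/ core U' Y' op fu.
Proof.
move=> h Uij nij hU hY.
(* The pair is the last chance of its end [i] to stay linked; if neither end is in this situation,
   the answer is 0. *)
pose bad i j := [/\ op i, forall z, U i z -> z = j & forall z, Y i z -> ~ live op fu z].
have spC a b : same_pair i j a b <-> same_pair j i a b.
  by split; case=> -[-> ->]; by [left|right].
have [[]|nbi] := pselect (bad i j); first by right; move=> *; apply: (core_attach h Uij nij hU hY).
have [[]|nbj] := pselect (bad j i).
  move=> oj Uj Yj; right; apply: (core_attach h (core_Usym h Uij)) => //.
  - by move=> e; apply: nij.
  - by move=> a b; rewrite hU spC.
  - by move=> a b; rewrite hY spC.
have spS a b : same_pair i j a b -> same_pair i j b a.
  by case=> -[-> ->]; [right|left].
have finW x : finished U x -> finished U' x by move=> fx z /hU[/fx].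
have leafW x : leaf U Y op fu x -> leaf U' Y op fu x.
  by case=> ox fx ux; split=> //; exact: finW.
have good a b : op a -> same_pair i j a b ->
    (exists2 z, U a z & z <> b) \/ (exists2 y, Y a y & live op fu y).
  move=> oa sp; apply: contrapT => /not_orP[n1 n2].
  have : bad a b.
    split=> // z az; first by apply: contrapT => zb; apply: n1; exists z.
    by move=> lz; apply: n2; exists z.
  by case: sp => -[-> ->].
left; split.
- by move=> x y /hU[/(core_Usym h) yx ns]; apply/hU; split=> // /spS.
- exact: core_Ysym h.
- exact: core_opfu h.
- by move=> x y /hU[/(core_live h)].
- move=> x ox; case: (core_linked h ox) => [[y xy]|]; last by right.
  have [sp|nsp] := pselect (same_pair i j x y); last by left; exists y; apply/hU.
  case: (good _ _ ox sp) => [[z xz zy]|]; last by right.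
  left; exists z; apply/hU; split=> // sp'; apply: zy.
  by case: sp sp' => -[-> ->] [][] // e; case: nij; rewrite e.
- by move=> x y xy lx ly; case: (core_leaf h xy lx ly) => /leafW; [left|right].
- by move=> x y /(core_fin h)[] /finW; [left|right].
- by move=> z x y zx zy xy; case: (core_fin2 h zx zy xy) => /finW; [left|right].
- exact: core_trifree h.
Qed.

Lemma core_init (A op fu : T -> Prop) : (forall x, op x -> ~ fu x) ->
  (forall x, A x -> live op fu x) ->
  (forall x, op x -> exists2 y, A x /\ A y & x <> y) ->
  core (fun x y => [/\ A x, A y & x <> y]) (fun _ _ => False) op fu.
Proof.
move=> opfu Al opA; split=> //.
- by move=> x y [Ax Ay xy]; split=> // e; apply: xy.
- by move=> x y [/Al].
- by move=> x /opA[y [Ax Ay] xy]; left; exists y.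
Qed.

Lemma core_ext U Y op fu U' Y' op' fu' :
  (forall a b, U a b <-> U' a b) -> (forall a b, Y a b <-> Y' a b) ->
  (forall a, op a <-> op' a) -> (forall a, fu a <-> fu' a) ->
  core U Y op fu -> core U' Y' op' fu'.
Proof.
move=> hU hY ho hf.
have -> : U' = U by apply/funext => a; apply/funext => b; apply/propext; rewrite hU.
have -> : Y' = Y by apply/funext => a; apply/funext => b; apply/propext; rewrite hY.
have -> : op' = op by apply/funext => a; apply/propext; rewrite ho.
by have -> : fu' = fu by apply/funext => a; apply/propext; rewrite hf.
Qed.

End Core.

(** * The clique game on the whole vertex set *)

Section Clique.
Variables (n k : nat) (S : {set 'I_n}).
Implicit Types (G : graph n) (e : edge n) (i j a b s t x : 'I_n) (U : {set edge n}).
Implicit Types (u y : rel 'I_n).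
Local Open Scope nat_scope.

Definition outer y a b : Prop := [/\ a \notin S, b \notin S & y a b].

Definition opened u x : Prop := x \notin S /\ exists2 s, s \in S & u s x.

(** When [S] is empty, that is for [k = 2], every vertex is full from the start and none is ever
    open. *)
Definition filled y x : Prop := x \notin S /\ forall s, s \in S -> y s x.

Definition base_ok u y : Prop := forall s t, s \in S -> t \in S -> s != t ->
  u s t \/ y s t.

(* [u] and [y] are the adjacency relations of the unqueried pairs and of the
   1-answers. *)
Definition main_state u y : Prop :=
  [/\ base_ok u y,
      core (outer u) (outer y) (opened u) (filled y),
      forall x s, opened u x -> s \in S -> u s x \/ y s x
    & exists a b, b \notin S /\ u a b].

(* Only pairs inside [S] are left, and the value of f is their conjunction. *)
Definition final_state u y : Prop :=
  [/\ base_ok u y,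
      forall a b c, outer y a b -> outer y b c -> outer y a c -> False,
      forall a b, u a b -> a \in S /\ b \in S
    & exists a b, [/\ outer y a b, filled y a & filled y b]].

(** A clique has at most two vertices outside [S] since there is no triangle there; by counting, it
    contains all of [S] and exactly two others. *)
Lemma CL_outer G : #|S| = k - 2 -> 2 <= k ->
  (forall a b c, outer (adj G) a b -> outer (adj G) b c -> outer (adj G) a c -> False) -> CL n k G ->
  (forall s t, s \in S -> t \in S -> s != t -> adj G s t) /\
  exists a b, [/\ outer (adj G) a b, filled (adj G) a & filled (adj G) b].
Proof.
move=> cS k2 trif /existsP[K /andP[/eqP cK /forall_inP hK]].
have adjK a b : a \in K -> b \in K -> a != b -> adj G a b.
  by move=> aK bK ab; have /forall_inP/(_ b bK)/implyP := hK a aK; apply.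
have cD : #|K :\: S| <= 2.
  rewrite leqNgt; apply/negP => /card_gt2P[a [b [c [[aK bK cK'] [ab bc ca]]]]].
  move: aK bK cK'; rewrite !inE => /andP[aS aK] /andP[bS bK] /andP[cS' cK'].
  have o1 : outer (adj G) a b by split=> //; exact: adjK.
  have o2 : outer (adj G) b c by split=> //; exact: adjK.
  have o3 : outer (adj G) a c by split=> //; apply: adjK => //; rewrite eq_sym.
  exact: trif o1 o2 o3.
have cI := cardsID S K; rewrite cK in cI.
have sI : #|K :&: S| <= #|S| by apply: subset_leq_card; exact: subsetIr.
have cIS : #|S| <= #|K :&: S|.
  by rewrite cS leq_subLR -cI addnC leq_add2r.
have sSK : S \subset K.
  have /eqP <- : K :&: S == S by rewrite eqEcard subsetIr.
  exact: subsetIl.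
have gD : 1 < #|K :\: S|.
  have e : #|K :&: S| = k - 2 by apply/eqP; rewrite eqn_leq -{1}cS sI -cS cIS.
  by rewrite -(leq_add2l #|K :&: S|) cI e subnK.
split.
  by move=> s t sS tS; apply: adjK; exact: (subsetP sSK).
have /card_gt1P[a [b [aK bK ab]]] := gD.
move: aK bK; rewrite !inE => /andP[aS aK] /andP[bS bK].
exists a, b; split; first by split=> //; exact: adjK.
  split=> [//|s sS]; apply: adjK => //; first exact: (subsetP sSK).
  by apply: contraNneq aS => <-.
split=> [//|s sS]; apply: adjK => //; first exact: (subsetP sSK).
by apply: contraNneq bS => <-.
Qed.

Lemma final_CL G : #|S| = k - 2 -> 2 <= k -> final_state (adj (graph_of set0)) (adj G) -> CL n k G.
Proof.
move=> cS k2 [hb _ _ [a [b [[aS bS ab] [_ fa] [_ fb]]]]].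
have U0 (x z : 'I_n) : adj (graph_of set0) x z = false.
  by apply/negbTE/negP => /adjP[e _]; rewrite ffunE inE.
apply/existsP; exists (a |: (b |: S)); apply/andP; split.
  rewrite !cardsU1 !inE (negbTE aS) (negbTE bS) (negbTE (adj_neq ab)) /= cS.
  by rewrite addnA subnKC.
apply/forall_inP => x xK; apply/forall_inP => z zK; apply/implyP => xz.
move: xK zK; rewrite !inE => /or3P[/eqP ex|/eqP ex|xS] /or3P[/eqP ez|/eqP ez|zS];
  rewrite ?ex ?ez //; rewrite ?ex ?ez ?eqxx // in xz.
- by rewrite adj_sym; exact: fa.
- by rewrite adj_sym.
- by rewrite adj_sym; exact: fb.
- exact: fa.
- exact: fb.
- by have [] := hb x z xS zS xz; rewrite ?U0.
Qed.

Lemma main_not_CL U G : #|S| = k - 2 -> 2 <= k -> main_state (adj (graph_of U)) (adj G) -> CL n k G = false.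
Proof.
move=> cS k2 [hb hc _ _]; apply/negbTE/negP => /(CL_outer cS k2 (core_trifree hc)).
by case=> _ [a [b [ab fa fb]]]; exact: (core_no_clique hc ab fa fb).
Qed.

(** * One query, according to the position of its ends *)

Section Step.
Variables (u y u' y' : rel 'I_n) (i j : 'I_n).
Hypotheses (uij : u i j) (nij : i != j) (unqueried_off : forall a b, u a b -> ~ y a b).
Hypotheses (step_unqueried : forall a b, u' a b <-> u a b /\ ~ same_pair i j a b).
Hypotheses (step_on : forall a b, y' a b <-> y a b \/ same_pair i j a b).

Lemma base_on : base_ok u y -> base_ok u' y'.
Proof.
move=> hb s t sS tS st; have [h|h] := hb s t sS tS st; last by right; apply/step_on; left.
have [sp|nsp] := pselect (same_pair i j s t); first by right; apply/step_on; right.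
by left; apply/step_unqueried.
Qed.

Lemma base_off : j \notin S -> base_ok u y -> base_ok u' y.
Proof.
move=> jS hb s t sS tS st; have [h|h] := hb s t sS tS st; last by right.
left; apply/step_unqueried; split=> // -[][es et]; move: jS; rewrite -?es -?et.
  by rewrite tS.
by rewrite sS.
Qed.

Lemma step_inner_outer a b : i \in S -> j \in S ->
  (outer u' a b <-> outer u a b) /\
  (outer y' a b <-> outer y a b).
Proof.
move=> iS jS; have ns : a \notin S -> ~ same_pair i j a b.
  by move=> aS [][ea _]; move: aS; rewrite ea ?iS ?jS.
split; split=> -[aS bS ab]; split=> //.
- by case/step_unqueried: ab.
- by apply/step_unqueried; split=> //; exact: ns.
- by case/step_on: ab => // /(ns aS).
- by apply/step_on; left.
Qed.

Lemma step_inner_bundle s x : i \in S -> j \in S -> x \notin S ->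
  (u' s x <-> u s x) /\
  (y' s x <-> y s x).
Proof.
move=> iS jS xS; have ns : ~ same_pair i j s x.
  by move=> [][_ ex]; move: xS; rewrite ex ?iS ?jS.
split; split.
- by case/step_unqueried.
- by move=> h; apply/step_unqueried.
- by case/step_on.
- by move=> h; apply/step_on; left.
Qed.

Lemma step_main_inner : i \in S -> j \in S -> main_state u y ->
  main_state u' y'.
Proof.
move=> iS jS [hb hc hbun [a [b [bS Uab]]]].
have oE x : opened u x <-> opened u' x.
  split=> -[xS [s sS h]]; split=> //; exists s => //;
    by apply/(step_inner_bundle s iS jS xS).1.
have fE x : filled y x <-> filled y' x.
  split=> -[xS h]; split=> [//|s sS]; have [_ [h1 h2]] := step_inner_bundle s iS jS xS.
    exact: (h2 (h s sS)).
  exact: (h1 (h s sS)).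
split.
- exact: base_on.
- apply: (core_ext _ _ oE fE hc) => a' b'.
    by rewrite (step_inner_outer a' b' iS jS).1.
  by rewrite (step_inner_outer a' b' iS jS).2.
- move=> x s /oE ox sS; have [xS _] := ox.
  have [h1 h2] := step_inner_bundle s iS jS xS.
  by rewrite h1 h2; exact: hbun.
- by exists a, b; split=> //; apply/(step_inner_bundle a iS jS bS).1.
Qed.

Lemma step_final : final_state u y -> final_state u' y'.
Proof.
move=> [hb ht hU [a [b [ab [aS fa] [bS fb]]]]].
have [iS jS] := hU _ _ uij.
split.
- exact: base_on.
- move=> x w z /(step_inner_outer x w iS jS).2 xw /(step_inner_outer w z iS jS).2 wz.
  by move=> /(step_inner_outer x z iS jS).2; exact: ht xw wz.
- by move=> x w /step_unqueried[/hU].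
- exists a, b; split; first by apply/(step_inner_outer a b iS jS).2.
    by split=> [//|s sS]; apply/step_on; left; exact: fa.
  by split=> [//|s sS]; apply/step_on; left; exact: fb.
Qed.

(** The last pair not inside [S] is answered 1. If it meets [S], then [j] is the only open vertex;
    it becomes full, and [core_last_op] provides its full neighbour. If not, no vertex is open any
    more, so by [core_live] both ends are full. *)
Lemma step_finish : j \notin S -> main_state u y ->
  (forall a b, u' a b -> a \in S /\ b \in S) ->
  final_state u' y'.
Proof.
move=> jS [hb hc hbun _] hU1.
have only a b : u a b -> b \notin S -> same_pair i j a b.
  move=> ab bS; apply: contrapT => ns.
  have [_ bS'] : a \in S /\ b \in S by apply: hU1; apply/step_unqueried.
  by rewrite bS' in bS.
have fW x : filled y x -> filled y' x.
  by move=> [xS h]; split=> [//|s sS]; apply/step_on; left; exact: h.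
have [iS|iS] := boolP (i \in S).
- have oj : opened u j by split=> //; exists i => //; exact: uij.
  have [||w jw fw] := core_last_op hc oj.
  + move=> x w [xS wS /only/(_ wS)[][ex ew]]; first by rewrite ex iS in xS.
    by rewrite ew iS in wS.
  + move=> x [xS [s sS /only/(_ xS)[][es ex]]] //.
    by rewrite -es sS in jS.
  have oW a b : outer y' a b <-> outer y a b.
    split=> -[aS bS ab]; split=> //; last by apply/step_on; left.
    case/step_on: ab => // -[][ea eb]; first by rewrite ea iS in aS.
    by rewrite eb iS in bS.
  split=> //.
  + exact: base_on.
  + by move=> x w' z /oW xw /oW wz /oW; exact: (core_trifree hc xw wz).
  + exists j, w; split; [exact/oW| |exact: fW].
    split=> [//|s sS]; apply/step_on; have [Usj|] := hbun j s oj sS; last by left.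
    by right; exact: only.
- have oij : outer u i j by split=> //; exact: uij.
  have nop x : ~ opened u x.
    move=> [xS [s sS /only/(_ xS)[][es _]]]; first by rewrite -es sS in iS.
    by rewrite -es sS in jS.
  have oE a b : outer y' a b <-> outer y a b \/ same_pair i j a b.
    split=> [[aS bS /step_on[ab|]]|[[aS bS ab]|sp]]; [by left|by right| |].
      by split=> //; apply/step_on; left.
    by case: sp => -[-> ->]; split=> //; apply/step_on; right; by [left|right].
  have fl x w : outer u x w -> filled y' x.
    by move=> /(core_live hc)[/nop//|]; exact: fW.
  split=> //.
  + exact: base_on.
  + exact: (core_add_trifree hc oij (elimN eqP nij) oE).
  + exists i, j; split; [by apply/oE; right; left|exact: fl oij|].
    exact: fl (core_Usym hc oij).
Qed.

(** As long as another pair from [S] to [j] is unqueried, the answer 1 changes neither the open nor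
    the full vertices. At the last such pair, [core_close] chooses between full (answer 1) and dead
    (answer 0). *)
Lemma step_bundle : i \in S -> j \notin S -> main_state u y ->
  (exists a b, b \notin S /\ u' a b) ->
  main_state u' y \/ main_state u' y'.
Proof.
move=> iS jS [hb hc hbun _] pend.
have Uij := uij.
have oj : opened u j by split=> //; exists i.
have spE s x : x \notin S -> same_pair i j s x -> s = i /\ x = j.
  by move=> xS [[]//|[_ ex]]; rewrite ex iS in xS.
have uE a b : outer u a b <-> outer u' a b.
  split=> -[aS bS ab]; split=> //; last by case/step_unqueried: ab.
  by apply/step_unqueried; split=> // /(spE _ _ bS)[ea _]; rewrite ea iS in aS.
have yE a b : outer y a b <-> outer y' a b.
  split=> -[aS bS ab]; split=> //; first by apply/step_on; left.
  by case/step_on: ab => // /(spE _ _ bS)[ea _]; rewrite ea iS in aS.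
have oW x : opened u' x -> opened u x.
  by move=> [xS [s sS /step_unqueried[h _]]]; split=> //; exists s.
have fW x : filled y x -> filled y' x.
  by move=> [xS h]; split=> [//|s sS]; apply/step_on; left; exact: h.
have bunW x s : opened u' x -> s \in S ->
    u' s x \/ y' s x.
  move=> ox sS; have [h|h] := hbun x s (oW x ox) sS; last by right; apply/step_on; left.
  have [sp|nsp] := pselect (same_pair i j s x); first by right; apply/step_on; right.
  by left; apply/step_unqueried.
have fS x : x <> j -> filled y' x -> filled y x.
  move=> xj [xS h]; split=> [//|s sS]; case/step_on: (h s sS) => // /(spE _ _ xS)[_ ex].
  by case: xj.
have oS x : x <> j -> opened u x -> opened u' x.
  move=> xj [xS [s sS sx]]; split=> //; exists s => //.
  by apply/step_unqueried; split=> // /(spE _ _ xS)[_ ex]; case: xj.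
have [[s' [s'S s'i Us'j]]|last] := pselect (exists s', [/\ s' \in S, s' <> i & u s' j]).
- right; split; [exact: base_on| |exact: bunW|exact: pend].
  have Us' : u' s' j.
    by apply/step_unqueried; split=> // /(spE _ _ jS)[].
  apply: (core_ext uE yE _ _ hc) => x; split.
  + have [->|xj] := pselect (x = j); last exact: oS.
    by move=> _; split=> //; exists s'.
  + exact: oW.
  + exact: fW.
  + have [->|xj] := pselect (x = j); last exact: fS.
    move=> [_ /(_ _ s'S)/step_on[/(unqueried_off Us'j)//|/(spE _ _ jS)[]//]].
- have noj : ~ opened u' j.
    move=> [_ [s sS /step_unqueried[sj ns]]]; apply: last; exists s; split=> // es.
    by apply: ns; left.
  have oE x : opened u x /\ x <> j <-> opened u' x.
    split=> [[ox xj]|ox]; first exact: oS.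
    by split; [exact: oW|move=> xj; apply: noj; rewrite -xj].
  case: (core_close hc oj) => hc'; [right|left].
  + split; [exact: base_on| |exact: bunW|exact: pend].
    apply: (core_ext uE yE oE _ hc') => x; split=> [[/fW|->]|fx]; first by apply.
      split=> [//|s sS]; apply/step_on; have [Usj|] := hbun j s oj sS; last by left.
      have [es|ns] := pselect (s = i); first by right; left.
      by case: last; exists s.
    by have [->|xj] := pselect (x = j); [right|left; exact: fS].
  + split; [exact: base_off| | |exact: pend].
      exact: (core_ext uE (fun _ _ => iff_refl _) oE (fun _ => iff_refl _) hc').
    move=> x s ox sS; have xj : x <> j by move=> e'; apply: noj; rewrite -e'.
    have [h|h] := hbun x s (oW x ox) sS; last by right.
    by left; apply/step_unqueried; split=> // /(spE _ _ ox.1)[_ ex].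
Qed.

(** The pairs to [S] are untouched, so open and full vertices stay the same and [core_edge] gives
    the answer. *)
Lemma step_outer : i \notin S -> j \notin S -> main_state u y ->
  (exists a b, b \notin S /\ u' a b) ->
  main_state u' y \/ main_state u' y'.
Proof.
move=> iS jS [hb hc hbun _] pend.
have oij : outer u i j by split=> //; exact: uij.
have nsp s x : s \in S -> ~ same_pair i j s x.
  by move=> sS [][es _]; move: sS; rewrite es ?(negbTE iS) ?(negbTE jS).
have uE a b : outer u' a b <->
    outer u a b /\ ~ same_pair i j a b.
  by split=> [[aS bS /step_unqueried[]]|[[aS bS ab] ns]] //; split=> //; apply/step_unqueried.
have yE a b : outer y' a b <-> outer y a b \/ same_pair i j a b.
  split=> [[aS bS /step_on[ab|]]|[[aS bS ab]|sp]]; [by left|by right| |].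
    by split=> //; apply/step_on; left.
  by case: sp => -[-> ->]; split=> //; apply/step_on; right; by [left|right].
have oE x : opened u x <-> opened u' x.
  split=> -[xS [s sS h]]; split=> //; exists s => //; last by case/step_unqueried: h.
  by apply/step_unqueried; split=> //; exact: nsp.
have fE x : filled y x <-> filled y' x.
  split=> -[xS h]; split=> [//|s sS]; first by apply/step_on; left; exact: h.
  by case/step_on: (h s sS) => // /(nsp _ _ sS).
have bunE x s : opened u' x -> s \in S ->
    u' s x \/ y s x.
  move=> /oE ox sS; have [h|h] := hbun x s ox sS; last by right.
  by left; apply/step_unqueried; split=> //; exact: nsp.
case: (core_edge hc oij (elimN eqP nij) uE yE) => hc'; [left|right].
- split; [exact: base_off| |exact: bunE|exact: pend].
  exact: (core_ext (fun _ _ => iff_refl _) (fun _ _ => iff_refl _) oE (fun _ => iff_refl _) hc').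
- split; [exact: base_on| | |exact: pend].
    exact: (core_ext (fun _ _ => iff_refl _) (fun _ _ => iff_refl _) oE fE hc').
  by move=> x s ox sS; have [h|h] := bunE x s ox sS; [left|right; apply/step_on; left].
Qed.

End Step.

Definition state u y : Prop := main_state u y \/ final_state u y.

Lemma same_pairC i j a b : same_pair j i a b <-> same_pair i j a b.
Proof. by split; case=> -[-> ->]; by [left|right]. Qed.

(** * The adversary's answers and the end of the game *)

Section Transition.
Variables (u y u' y' : rel 'I_n) (i j : 'I_n).
Hypotheses (usym : symmetric u) (uij : u i j) (nij : i != j).
Hypothesis off : forall a b, u a b -> ~ y a b.
Hypothesis hu : forall a b, u' a b <-> u a b /\ ~ same_pair i j a b.
Hypothesis hy : forall a b, y' a b <-> y a b \/ same_pair i j a b.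

(** The steps for pairs not inside [S] want [j] outside [S]; the swapped facts serve the other
    orientation. *)
Let uji : u j i. Proof. by rewrite usym. Qed.
Let nji : j != i. Proof. by rewrite eq_sym. Qed.
Let hu' a b : u' a b <-> u a b /\ ~ same_pair j i a b.
Proof. by rewrite hu same_pairC. Qed.
Let hy' a b : y' a b <-> y a b \/ same_pair j i a b.
Proof. by rewrite hy same_pairC. Qed.

Lemma main_last : main_state u y -> (forall a b, u' a b -> a \in S /\ b \in S) ->
  final_state u' y'.
Proof.
move=> hm np.
have [jS|jS] := boolP (j \in S); last exact: (step_finish uij nij hu hy).
have [iS|iS] := boolP (i \in S); last exact: (step_finish uji nji hu' hy').
case: hm => [_ _ _ [a [b [bS ab]]]].
have ns : ~ same_pair i j a b by move=> [][_ eb]; rewrite eb ?iS ?jS in bS.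
by have [_] : a \in S /\ b \in S; [apply: np; apply/hu|rewrite (negbTE bS)].
Qed.

Lemma state_answer : state u y -> state u' y \/ state u' y'.
Proof.
case=> [hm|hf]; last by right; right; exact: (step_final uij hu hy).
have u'sym a b : u' a b -> u' b a.
  move=> /hu[ab ns]; apply/hu; split; first by rewrite usym.
  by move=> sp; apply: ns; case: sp => -[-> ->]; by [left|right].
have wrap : main_state u' y \/ main_state u' y' -> state u' y \/ state u' y'.
  by case=> h; [left|right]; left.
(* The main phase lasts while another pair not inside [S] is unqueried; otherwise this query opens
   the final phase. *)
have [pend|np] := pselect (exists a b, b \notin S /\ u' a b); last first.
  right; right; apply: main_last => // a b ab.
  split; apply: contrapT => /negP h; apply: np; last by exists a, b.
  by exists b, a; split=> //; exact: u'sym.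
have [iS|iS] := boolP (i \in S); have [jS|jS] := boolP (j \in S).
- by right; left; exact: (step_main_inner hu hy).
- by apply: wrap; exact: (step_bundle uij off hu hy).
- by apply: wrap; exact: (step_bundle uji off hu' hy').
- by apply: wrap; exact: (step_outer uij nij hu hy).
Qed.

End Transition.

Definition clique_state U G : Prop := state (adj (graph_of U)) (adj G).

Lemma unqueried_off U G : (forall e, e \in U -> G e = false) ->
  forall a b, adj (graph_of U) a b -> ~ adj G a b.
Proof. by move=> off a b /adjP[e he]; rewrite ffunE (adj_edge _ he) => /off ->. Qed.

Lemma same_pairE e i j a b : val e = [set i; j] -> same_pair i j a b <-> val e = [set a; b].
Proof.
move=> ->; split=> [[][-> ->] //|/eqP]; first by rewrite setUC.
rewrite set2_eq => /orP[]/andP[/eqP-> /eqP->]; by [left|right].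
Qed.

Lemma adj_graph_ofD1P U e i j a b : val e = [set i; j] ->
  adj (graph_of (U :\ e)) a b <-> adj (graph_of U) a b /\ ~ same_pair i j a b.
Proof.
move=> he; rewrite adj_graph_ofD1 (same_pairE _ _ he).
by split=> [/andP[h /eqP ne]|[-> /eqP ->]].
Qed.

Lemma adj_switch_onP G e i j a b : val e = [set i; j] ->
  adj (switch_on G e) a b <-> adj G a b \/ same_pair i j a b.
Proof.
move=> he; rewrite adj_switch_on (same_pairE _ _ he).
by split=> [/orP[h|/eqP ne]|[->|->]]; [left|right| |rewrite eqxx orbT].
Qed.

Lemma clique_answer U G e : e \in U -> (forall w, w \in U -> G w = false) ->
  clique_state U G -> clique_state (U :\ e) G \/ clique_state (U :\ e) (switch_on G e).
Proof.
move=> eU disj; have [i [j [nij he]]] := edgeP e.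
apply: (@state_answer _ _ _ _ i j) => //.
- by move=> a b; rewrite adj_sym.
- by rewrite (adj_edge _ he) ffunE.
- exact: unqueried_off.
- by move=> a b; exact: adj_graph_ofD1P.
- by move=> a b; exact: adj_switch_onP.
Qed.

(** In the main phase no clique exists yet and the answer 1 leads to a final state with nothing
    unqueried. In the final phase [e] lies inside [S], and every possible clique contains it. *)
Lemma clique_last G e : #|S| = k - 2 -> 2 <= k -> G e = false ->
  clique_state [set e] G -> CL n k G = false /\ CL n k (switch_on G e).
Proof.
move=> cS k2 Ge st; have [i [j [nij he]]] := edgeP e.
have disj w : w \in [set e] -> G w = false by rewrite inE => /eqP ->.
have uij : adj (graph_of [set e]) i j by rewrite (adj_edge _ he) ffunE inE.
have DE : [set e] :\ e = set0 by rewrite setDv.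
have hu a b : adj (graph_of set0) a b <-> adj (graph_of [set e]) a b /\ ~ same_pair i j a b.
  by rewrite -DE; exact: adj_graph_ofD1P.
have hy a b := adj_switch_onP G a b he.
case: st => [hm|hf]; split.
- exact: main_not_CL hm.
- apply: final_CL => //; apply: (main_last _ uij nij hu hy hm).
    by move=> a b; rewrite adj_sym.
  by move=> a b /adjP[e' _]; rewrite ffunE inE.
- case: hf => [_ ht hU _]; apply/negbTE/negP => /(CL_outer cS k2 ht)[hS _].
  have [iS jS] := hU _ _ uij.
  exact: (unqueried_off disj uij (hS _ _ iS jS nij)).
- by apply: final_CL => //; exact: (step_final uij hu hy).
Qed.

(** Two vertices outside [S] give each open vertex an unqueried pair outside [S], and the main phase
    a pending pair. *)
Lemma clique_init : 1 < #|~: S| -> clique_state [set: edge n] [ffun=> false].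
Proof.
move=> /card_gt1P[p [q [pS qS pq]]]; rewrite !inE in pS qS.
left; split.
- by move=> s t _ _ st; left; rewrite adj_graph_ofT.
- apply: (@core_ext _ (fun x z : 'I_n => [/\ x \notin S, z \notin S & x <> z]) (fun _ _ => False)
    (opened (adj (graph_of setT))) (filled (adj ([ffun=> false] : graph n)))).
  + by move=> a b; split=> -[aS bS ab]; split=> //; move: ab; rewrite adj_graph_ofT => /eqP.
  + by move=> a b; split=> // -[_ _]; rewrite adj0.
  + by [].
  + by [].
  + apply: core_init.
    * by move=> x [xS [s sS _]] [_ /(_ s sS)]; rewrite adj0.
    * move=> x xS; have [S0|/set0Pn[s sS]] := eqVneq S set0.
        by right; split=> // s; rewrite S0 inE.
      left; split=> //; exists s => //; rewrite adj_graph_ofT.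
      by apply: contraNneq xS => <-.
    * move=> x [xS _]; have [xp|/eqP xp] := eqVneq x p; last by exists p.
      by exists q => //; rewrite xp; apply/eqP.
- by move=> x s [xS _] sS; left; rewrite adj_graph_ofT; apply: contraNneq xS => <-.
- by exists p, q; rewrite adj_graph_ofT.
Qed.

End Clique.

(** * Independent sets and the size of clique certificates *)

Lemma greedy_independent (T : finType) (r : rel T) (d k : nat) (W : {set T}) :
  symmetric r -> (0 < d)%N -> (k * d <= #|W|)%N ->
  (forall v, v \in W -> #|[set w | r v w]| < d)%N ->
  exists K : {set T}, [/\ K \subset W, #|K| = k &
    forall x y, x \in K -> y \in K -> x != y -> ~~ r x y].
Proof.
move=> rs d0; elim: k W => [|k IH] W kW hd.
  by exists set0; split=> [||x y]; rewrite ?sub0set ?cards0 ?inE.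
have /card_gt0P[v vW] : (0 < #|W|)%N by apply: leq_trans kW; rewrite muln_gt0.
(* Choosing [v] discards at most [d] vertices: itself and fewer than [d] neighbours. *)
pose W' := W :\: (v |: [set w | r v w]).
have [||K [sK cK hK]] := IH W'.
- have := cardsID (v |: [set w | r v w]) W; rewrite -/W'.
  have : (#|W :&: (v |: [set w | r v w])| <= d)%N.
    apply: leq_trans (subset_leq_card (subsetIr _ _)) _.
    apply: leq_trans (leq_card_setU _ _) _.
    by rewrite cards1; exact: hd.
  by rewrite mulSn in kW; lia.
- by move=> w; rewrite inE => /andP[_ /hd].
have hv w : w \in K -> [/\ w != v, ~~ r v w & w \in W].
  move=> /(subsetP sK); rewrite !inE negb_or => /andP[/andP[]]; by split.
exists (v |: K); split.
- rewrite subUset sub1set vW; apply/subsetP => w /hv[] //.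
- rewrite cardsU1 cK (_ : v \notin K) //; by apply/negP => /hv[]; rewrite eqxx.
- move=> x y; rewrite !inE => /orP[/eqP->|xK] /orP[/eqP->|yK].
  + by rewrite eqxx.
  + by case: (hv y yK).
  + by rewrite rs; case: (hv x xK).
  + exact: hK.
Qed.

Section CliqueCertificates.
Variable n : nat.
Implicit Types (G : graph n) (e : edge n) (i j v w : 'I_n) (U : {set edge n}).
Local Open Scope nat_scope.

Lemma CL_mono k G G' : (forall e, G e -> G' e) -> CL n k G -> CL n k G'.
Proof.
move=> sG /existsP[K /andP[cK /forall_inP hK]]; apply/existsP; exists K.
rewrite cK; apply/forall_inP => i iK; apply/forall_inP => j jK.
have /forall_inP/(_ j jK)/implyP h := hK i iK.
by apply/implyP => /h/adjP[e he /sG Ge]; apply/adjP; exists e.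
Qed.

Definition clique_edges (K : {set 'I_n}) : {set edge n} := [set e : edge n | (val e : {set _}) \subset K].

Lemma card_clique_edges K : #|clique_edges K| = 'C(#|K|, 2).
Proof.
rewrite -cards_draws -(card_imset _ val_inj); apply: eq_card => A; rewrite !inE.
apply/imsetP/andP => [[e]|[AK cA]].
  by rewrite inE => eK ->; split=> //; exact: (valP e).
by exists (Sub A cA); rewrite ?inE.
Qed.

Lemma CL_clique k G : CL n k G -> exists K : {set 'I_n}, #|K| = k /\
  forall e, e \in clique_edges K -> G e.
Proof.
case/existsP=> K /andP[/eqP cK /forall_inP hK]; exists K; split=> // e.
have [i [j [nij he]]] := edgeP e.
rewrite inE he subUset !sub1set => /andP[iK jK].
have /forall_inP/(_ j jK)/implyP/(_ nij) := hK i iK.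
by rewrite (adj_edge _ he).
Qed.

Lemma CL_C_le k G : CL n k G -> C (CL n k) G <= 'C(k, 2).
Proof.
move=> cG; have [K [cK hK]] := CL_clique cG.
apply: leq_trans (C_le_card (S := clique_edges K) _) _; last by rewrite card_clique_edges cK.
apply/forallP => y; apply/implyP => /forall_inP hy; rewrite cG; apply/eqP.
apply/existsP; exists K; rewrite cK eqxx; apply/forall_inP => i iK.
apply/forall_inP => j jK; apply/implyP => /ex_edge[e he].
have eK : e \in clique_edges K by rewrite inE he subUset !sub1set iK.
by apply/adjP; exists e => //; rewrite (eqP (hy e eK)) hK.
Qed.

Definition degree U v := #|[set e : edge n in U | v \in (val e : {set _})]|.

Lemma neighbours_degree U v : #|[set w | adj (graph_of U) v w]| <= degree U v.
Proof.
pose E := [set e : edge n in U | v \in (val e : {set _})].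
have <- : #|[set (val e : {set 'I_n}) | e in E]| = degree U v.
  by apply: card_imset; exact: val_inj.
rewrite -(@card_in_imset _ _ (fun w => [set v; w])).
  apply/subset_leq_card/subsetP => _ /imsetP[w wN ->].
  move: wN; rewrite inE => /adjP[e he]; rewrite ffunE => eU; apply/imsetP; exists e; last by rewrite he.
  by rewrite inE eU he set21.
move=> a b _ _ /eqP; rewrite set2_eq => /orP[/andP[_ /eqP //]|/andP[/eqP <- /eqP ->]] //.
Qed.

(** Double counting of incidences, each pair having two ends. *)
Lemma sum_degree U : \sum_v degree U v = #|U| * 2.
Proof.
under eq_bigr => v _ do rewrite /degree -sum1_card big_mkcond /=.
rewrite exchange_big /= -sum_nat_const [RHS]big_mkcond /=; apply: eq_bigr => e _.
case eU : (e \in U).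
  transitivity #|(val e : {set 'I_n})|; last exact: eqP (valP e).
  rewrite -sum1_card [RHS]big_mkcond.
  by apply: eq_bigr => v _; rewrite inE eU.
by apply: big1 => v _; rewrite inE eU.
Qed.

Lemma sparse_CL k U : 4 * k <= n -> 8 * k ^ 3 <= n ^ 2 -> #|U| * 2 <= k ^ 2 ->
  CL n k [ffun e => e \notin U].
Proof.
move=> k4 k8 Uk.
have [n0|n0] := posnP n.
  have k0 : k = 0 by move: k4; rewrite [X in _ <= X]n0; lia.
  apply/existsP; exists set0; rewrite cards0 k0 eqxx.
  by apply/forall_inP => i; rewrite inE.
(* [d] is the least integer with [2 * k ^ 2 < d * n]. It is large enough for fewer than half of the
   vertices to have degree at least [d], and small enough for the greedy choice. *)
pose q := (2 * k ^ 2) %/ n; pose d := q.+1.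
have dn : 2 * k ^ 2 < d * n by exact: ltn_ceil.
have qn : q * n <= 2 * k ^ 2 by exact: leq_trunc_div.
pose L := [set v | degree U v < d].
have bad : #|~: L| * d <= k ^ 2.
  apply: leq_trans Uk; rewrite -sum_degree -sum_nat_const.
  rewrite [leqRHS](bigID (fun v => v \in ~: L)) /=; apply: leq_trans (leq_addr _ _).
  by apply: leq_sum => v; rewrite !inE -leqNgt.
have bad2 : 2 * #|~: L| < n.
  rewrite -(ltn_pmul2r (_ : 0 < d)) //; apply: leq_ltn_trans (_ : _ <= 2 * k ^ 2) _.
    by rewrite -mulnA leq_mul2l bad.
  by rewrite mulnC [n * d]mulnC in dn *.
(* [k * q] is at most [2 * k ^ 3 / n], hence at most [n / 4], and the extra [k] in [k * d] is at
   most [n / 4] too. *)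
have kd : 2 * (k * d) <= n.
  rewrite -(leq_pmul2r n0).
  have h1 : k * (q * n) <= k * (2 * k ^ 2) by rewrite leq_mul2l qn orbT.
  have h2 : 4 * k * n <= n * n by rewrite leq_mul2r k4 orbT.
  have e3 : k * (2 * k ^ 2) = 2 * k ^ 3 by rewrite mulnCA -expnS.
  have e2 : n ^ 2 = n * n by [].
  have e4 : 2 * (k * d) * n = 2 * (k * (q * n)) + 2 * (k * n) by rewrite /d; nia.
  by rewrite e4; rewrite e3 in h1; rewrite e2 in k8; lia.
have cL : #|L| + #|~: L| = n by rewrite cardsC card_ord.
have [||||K [_ cK hK]] := @greedy_independent _ (adj (graph_of U)) d k L.
- by move=> i j; rewrite adj_sym.
- by [].
- lia.
- by move=> v; rewrite inE; exact: leq_ltn_trans (neighbours_degree _ _).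
apply/existsP; exists K; rewrite cK eqxx; apply/forall_inP => i iK.
apply/forall_inP => j jK; apply/implyP => nij.
have := hK i j iK jK nij; have [e he] := ex_edge nij.
by rewrite !(adj_edge _ he) !ffunE.
Qed.

Lemma CL_certificate_card k G U : 4 * k <= n -> 8 * k ^ 3 <= n ^ 2 ->
  certificate (CL n k) G U -> 'C(k, 2) <= #|U|.
Proof.
move=> k4 k8 cU; case fG : (CL n k G).
  have [K [<- hK]] := CL_clique (certificate_true cU fG).
  rewrite -card_clique_edges; apply/subset_leq_card/subsetP => e /hK.
  by rewrite ffunE => /andP[].
rewrite leqNgt; apply/negP => ltU.
suff h : CL n k [ffun e => (e \in U) ==> G e] by rewrite (certificate_false cU fG) in h.
apply: CL_mono (sparse_CL (U := U) k4 k8 _).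
  by move=> e; rewrite !ffunE => /negbTE ->.
have : 'C(k, 2) * 2 <= k ^ 2 by rewrite bin2 muln2 -[leqRHS]mulnn; have := odd_double_half (k * k.-1); nia.
lia.
Qed.

Lemma clique_evasive k (T : dtree (edge n)) : 2 <= k <= n -> computes T (CL n k) ->
  exists2 G, C (CL n k) G <= 'C(k, 2) & #|{: edge n}| <= queries T G.
Proof.
move=> /andP[k2 kn] cT.
have [S cS] : exists S : {set 'I_n}, #|S| = k - 2.
  have : 0 < #|[set A : {set 'I_n} | #|A| == k - 2]|.
    by rewrite card_draws card_ord bin_gt0 (leq_trans (leq_subr _ _)).
  by move=> /card_gt0P[S]; rewrite inE => /eqP; exists S.
have [||||e [G [PG Ge qG]]] := @adversary_evasive _ (CL n k) (clique_state S) _ _ T _ _ cT.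
- by move=> U x v vU _ hx; exact: clique_answer.
- by move=> u x xu st; exact: clique_last st.
- by rewrite card_edge bin_gt0 (leq_trans k2).
(* As [k <= n], at least two vertices lie outside [S]. *)
- by apply: clique_init; have := cardsC S; rewrite card_ord cS; lia.
exists (switch_on G e) => //.
by apply: CL_C_le; have [] := clique_last cS k2 Ge PG.
Qed.

End CliqueCertificates.

(** * The values of [InstC] for [CONN] and [CL] *)

Theorem theorem4p3 (R : realType) :
  (forall n : nat, (2 <= n)%N ->
     InstC R (CONN n) = (DT (CONN n))%:R / (Cmin (CONN n))%:R /\
     (DT (CONN n))%:R / (Cmin (CONN n))%:R = 'C(n, 2)%:R / (n%:R - 1) :> R) /\
  (exists c : R, 0 < c /\
     forall n k : nat, (2 <= n)%N -> (2 <= k)%N ->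
       k%:R <= c * n%:R `^ (2 / 3) ->
       InstC R (CL n k) = (DT (CL n k))%:R / (Cmin (CL n k))%:R /\
       (DT (CL n k))%:R / (Cmin (CL n k))%:R
         = 'C(n, 2)%:R / 'C(k, 2)%:R :> R).
Proof.
split=> [n n2|].
  have [||||-> [eD eC]] := @InstC_evasive _ (CONN n) R n.-1.
  - by rewrite -ltnS prednK // (leq_trans _ n2).
  - rewrite card_edge; case: n n2 => // -[//|m] _.
    by rewrite binS bin1 leq_addl.
  - exact: CONN_certificate_card.
  - by move=> T; exact: conn_evasive.
  split=> //; rewrite eD eC card_edge; congr (_ / _).
  by rewrite -subn1 natrB // (leq_trans _ n2).
(* With this constant the cube of the hypothesis reads [(8 * k) ^ 3 <= n ^ 2], which is stronger
   than both conditions on [k] and [n] in the certificate bound. *)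
exists 8^-1; split=> // n k n2 k2 hk.
have h3 : (8 * k)%:R ^+ 3 <= n%:R ^+ 2 :> R.
  have -> : n%:R ^+ 2 = (n%:R `^ (2 / 3)) ^+ 3 :> R.
    by rewrite -!powR_mulrn ?powR_ge0 // -powRrM divfK.
  rewrite lerXn2r ?nnegrE ?powR_ge0 //.
  by rewrite natrM -ler_pdivlMl.
rewrite -!natrX ler_nat in h3.
have k8 : (8 * k ^ 3 <= n ^ 2)%N by apply: leq_trans h3; rewrite expnMn leq_mul2r orbT.
(* After squaring: [4 ^ 2 * k ^ 2 <= 8 ^ 3 * k ^ 2 <= 8 ^ 3 * k ^ 3 <= n ^ 2]. *)
have k4 : (4 * k <= n)%N.
  rewrite -leq_sqr; apply: leq_trans h3; rewrite !expnMn.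
  apply: (@leq_trans (8 ^ 3 * k ^ 2)); first by rewrite leq_mul2r orbT.
  by rewrite leq_mul2l leq_exp2l ?orbT.
have kn : (2 <= k <= n)%N by lia.
have [||||-> [eD eC]] := @InstC_evasive _ (CL n k) R 'C(k, 2).
- by rewrite bin_gt0.
- by rewrite card_edge; apply: leq_bin2l; lia.
- by move=> G U; exact: CL_certificate_card.
- by move=> T; exact: clique_evasive.
by rewrite eD eC card_edge.
Qed.
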